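(* Let $X$ and $Y$ be real linear topological spaces, and fix a notion of differentiability which satisfies the Chain Rule. If $X$ satisfies the blid-differentiable property (with respect to this notion), then every differentiable germ $[f]: X\to Y$ at $0\in X$ has a global differentiable representative; that is, for every map $f:U\to Y$ defined and differentiable on a neighborhood $U$ of $0$ in $X$ there exist a map $F:X\to Y$, differentiable on all of $X$ in the same sense, and a neighborhood $V\subset U$ of $0$ such that $F(x)=f(x)$ for all $x\in V$.
   Context: Differentiability. For linear topological spaces $X,Y$, a map $f:U\subset X\to Y$ is differentiable at $x\in U$ ($U$ a neighborhood of $x$) if $f(x+h)=f(x)+Ah+r(h)$ with $A:X\to Y$ a continuous linear operator and $r(h)=o(h)$; each meaning of ''$r(h)=o(h)$'' gives a notion of differentiability. A map is differentiable on a set if it is differentiable at every point of it. The notion of differentiability is fixed and assumed to satisfy the Chain Rule: if $g$ is differentiable at $x$ and $f$ is differentiable at $g(x)$, then $f\circ g$ is differentiable at $x$ with derivative $f'(g(x))g'(x)$. Examples of such notions: (i) bounded differentiability: for every bounded set $S\subset X$, $r(th)/t\to 0$ as $t\to 0$ ($t\in\mathbb{R}$), uniformly in $h\in S$; (ii) compact (Hadamard) differentiability: $f(x+t_nh_n)-f(x)=t_nAh+o(t_n)$ whenever $t_n\to 0$ in $\mathbb{R}$ and $h_n\to h$ in $X$; (iii) Fréchet differentiability when $X,Y$ are Banach spaces. Germs. A germ $[f]$ at $0\in X$ is an equivalence class of maps into $Y$ defined on neighborhoods of $0$, any two of which coincide on some neighborhood of $0$; its elements are called representatives. A germ is differentiable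 if it has a representative differentiable on a neighborhood of $0$. A global representative is one defined on all of $X$. Blid-differentiable property. $X$ satisfies the blid-differentiable property if for every neighborhood $U\subset X$ of $0$ there is a differentiable map $H:X\to X$, defined on all of $X$, which coincides with the identity map on some neighborhood of $0$, and such that $H(X)\subset U$. *)

(* Defs.v *)
From HB Require Import structures.
From mathcomp Require Import all_boot all_order all_algebra.
From mathcomp Require Import all_classical all_reals all_analysis.

Set Implicit Arguments.
Unset Strict Implicit.
Unset Printing Implicit Defensive.

Import Order.TTheory GRing.Theory Num.Theory.

Local Open Scope classical_set_scope.
Local Open Scope ring_scope.

(* A map f : D -> Y on a subset D of X is encoded by D together with a total
   function of which only the values on D are meaningful: no property of f defined
   below depends on the values off D. *)
Record partial_map (X Y : Type) := PartialMap { dom : set X ; pfun :> X -> Y }.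

Definition total_map (X Y : Type) (F : X -> Y) : partial_map X Y := PartialMap setT F.

Definition comp_map (X Y Z : Type) (f : partial_map Y Z) (g : partial_map X Y) : partial_map X Z :=
  PartialMap (dom g `&` g @^-1` dom f) (f \o g).

(* A meaning of "r(h) = o(h)", for remainders r : D -> Y with D a subset of X.
   It is completely arbitrary; one that makes sense only for certain spaces
   (such as Banach spaces) is covered by letting it be False elsewhere. *)
Definition little_o_notion (R : realType) :=
  forall X Y : topologicalLmodType R, partial_map X Y -> Prop.

Section Differentiability.
Context (R : realType) (o : little_o_notion R).

(* The existential over r makes the condition independent of the values of f
   off its domain and of those of r where f (x + h) is undefined. *)
Definition is_derivative (X Y : topologicalLmodType R) (f : partial_map X Y) (x : X)
    (A : {linear X -> Y}) : Prop :=
  [/\ nbhs x (dom f), continuous A &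
    exists2 r : X -> Y,
      forall h, dom f (x + h) -> f (x + h) = f x + A h + r h &
      o (PartialMap [set h | dom f (x + h)] r)].

Definition differentiable_at (X Y : topologicalLmodType R) (f : partial_map X Y)
    (x : X) : Prop :=
  exists A : {linear X -> Y}, is_derivative f x A.

Definition differentiable_on (X Y : topologicalLmodType R) (f : partial_map X Y)
    (S : set X) : Prop :=
  forall x, S x -> differentiable_at f x.

(* Differentiability need not imply continuity, so that the composite has to be
   assumed to be defined on a neighborhood of x. *)
Definition chain_rule : Prop :=
  forall (X Y Z : topologicalLmodType R) (g : partial_map X Y) (f : partial_map Y Z) (x : X)
    (A : {linear X -> Y}) (B : {linear Y -> Z}),
    nbhs x (dom (comp_map f g)) ->
    is_derivative g x A -> is_derivative f (g x) B ->
    is_derivative (comp_map f g) x (B \o A).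

Definition blid_differentiable (X : topologicalLmodType R) : Prop :=
  forall U : set X, nbhs 0 U ->
    exists H : X -> X,
      [/\ differentiable_on (total_map H) setT,
          (exists2 V : set X, nbhs 0 V & forall x, V x -> H x = x) &
          range H `<=` U].

End Differentiability.

Section Germs.
Context (R : realType) (X Y : topologicalLmodType R).

Definition germ_equiv (f g : partial_map X Y) : Prop :=
  exists2 V : set X, nbhs 0 V & forall x, V x -> [/\ dom f x, dom g x & f x = g x].

Record germ := Germ {
  representatives : set (partial_map X Y) ;
  germP : exists2 f : partial_map X Y,
    nbhs 0 (dom f) & representatives = [set g | germ_equiv f g] }.

Definition germ_differentiable (o : little_o_notion R) (G : germ) : Prop :=
  exists2 f : partial_map X Y, representatives G f &
    exists2 W : set X, nbhs 0 W & differentiable_on o f W.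

Definition global_representative (G : germ) (F : X -> Y) : Prop :=
  representatives G (total_map F).

End Germs.

(* Main.v *)
Require Import Defs.
From HB Require Import structures.
From mathcomp Require Import all_boot all_order all_algebra.
From mathcomp Require Import all_classical all_reals all_analysis.

Set Implicit Arguments.
Unset Strict Implicit.
Unset Printing Implicit Defensive.

Import Order.TTheory GRing.Theory Num.Theory.

Local Open Scope classical_set_scope.
Local Open Scope ring_scope.

(** A blid map [H] whose range lies in a neighborhood [W] of [0] on which [f] is
    differentiable pulls [f] back to a global map [f \o H].  Every point of [X]
    is sent by [H] into [W], so the Chain Rule makes [f \o H] differentiable
    everywhere; and [H] is the identity near [0], so [f \o H] has the same germ
    as [f] ([blid_extension]). *)

(** Totality of the composite supplies the neighborhood on which the Chain Rule
    requires it to be defined, and identifies it with a [total_map] even though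
    [f] itself is partial. *)
Lemma differentiable_comp_total (R : realType) (o : little_o_notion R)
    (chain : chain_rule o) (X Y Z : topologicalLmodType R)
    (g : X -> Y) (f : partial_map Y Z) (x : X) :
  range g `<=` dom f ->
  differentiable_at o (total_map g) x -> differentiable_at o f (g x) ->
  differentiable_at o (total_map (f \o g)) x.
Proof.
move=> gf [A dg] [B df]; exists (B \o A).
have domE : dom (comp_map f (total_map g)) = setT.
  by apply/seteqP; split=> // y _; split=> //; apply: gf; exists y.
have -> : total_map (f \o g) = comp_map f (total_map g).
  by rewrite [LHS]/total_map -domE.
apply: (chain _ _ _ _ _ _ _ _ _ dg df); rewrite domE; exact: filterT.
Qed.

Lemma differentiable_on_sub_dom (R : realType) (o : little_o_notion R)
    (X Y : topologicalLmodType R) (f : partial_map X Y) (W : set X) :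
  differentiable_on o f W -> W `<=` dom f.
Proof. by move=> df x /df[A [/nbhs_singleton]]. Qed.

(** The form common to germs and to maps on a neighborhood: [W] need not be the
    domain of [f], since a differentiable representative of a germ may be
    differentiable only on a smaller neighborhood. *)
Lemma blid_extension (R : realType) (o : little_o_notion R)
    (chain : chain_rule o) (X Y : topologicalLmodType R)
    (blid : blid_differentiable o X) (f : partial_map X Y) (W : set X) :
  nbhs 0 W -> differentiable_on o f W ->
  exists (F : X -> Y) (V : set X),
    [/\ differentiable_on o (total_map F) setT, nbhs 0 V, V `<=` W &
        forall x, V x -> F x = f x].
Proof.
move=> W0 df; have [H [dH [V V0 HV] HW]] := blid _ W0.
exists (f \o H), (V `&` W); split=> [x _||y []//|x [Vx _]].
- apply: differentiable_comp_total => //; last by apply/df/HW; exists x.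
  + exact: subset_trans HW (differentiable_on_sub_dom df).
  + exact: dH.
- exact: filterI.
- by rewrite /= HV.
Qed.

Theorem proposition3p2 (R : realType) (o : little_o_notion R)
    (chain : chain_rule o) (X Y : topologicalLmodType R)
    (blid : blid_differentiable o X) :
  (forall G : germ X Y, germ_differentiable o G ->
    exists2 F : X -> Y,
      global_representative G F & differentiable_on o (total_map F) setT) /\
  (forall (U : set X) (f : X -> Y),
    nbhs 0 U -> differentiable_on o (PartialMap U f) U ->
    exists (F : X -> Y) (V : set X),
      [/\ differentiable_on o (total_map F) setT, nbhs 0 V, V `<=` U &
          forall x, V x -> F x = f x]).
Proof.
split=> [G [f Gf [W W0 df]]|U f U0 df]; last first.
  exact: (blid_extension chain blid U0 df).
have [F [V [dF V0 _ FV]]] := blid_extension chain blid W0 df.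
exists F => //; rewrite /global_representative.
have [f0 _ GE] := germP G; move: Gf; rewrite GE => -[V' V'0 f0f].
exists (V `&` V'); first exact: filterI.
by move=> x [Vx /f0f[f0x _ f0fx]]; split=> //=; rewrite f0fx FV.
Qed.
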